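(* Let $X:[0,T]\to\mathbb{R}$ be a real-valued, centered, continuous Gaussian process with covariance $R_X(s,t)=\mathbb{E}X_sX_t$ and Cameron--Martin space $\mathcal{H}$. Let $\rho\in[1,2)$ and assume that $R_X$ has finite mixed $(1,\rho)$-variation, i.e. $V_{1,\rho}(R_X;[0,T]^2)<\infty$. Put $q=\big(\frac1{2\rho}+\frac12\big)^{-1}$. Then complementary Young regularity holds; that is, one can choose $p>2\rho$ small enough such that $X$ has almost surely sample paths of finite $p$-variation, every $h\in\mathcal{H}$ has finite $q$-variation, and $\frac1p+\frac1q>1$.
   Context: Cameron--Martin space: $\mathcal{H}\subset C([0,T],\mathbb{R})$ consists of the functions $h_t=\mathbb{E}[ZX_t]$ with $Z$ in the $L^2$-closure of $\operatorname{span}\{X_t: t\in[0,T]\}$, with $\langle h,h'\rangle_{\mathcal{H}}=\mathbb{E}[ZZ']$. $\mathcal{D}([s,t])$ is the set of all (finite) dissections of $[s,t]$. A path $h$ has finite $q$-variation if $\sup_{(t_i)\in\mathcal{D}([0,T])}\sum_i|h_{t_{i+1}}-h_{t_i}|^q<\infty$. Rectangular increments: $R\binom{s,t}{u,v}=R(s,u)-R(s,v)-R(t,u)+R(t,v)$. For $\gamma,\rho\ge1$, $$V_{\gamma,\rho}(R;[s,t]\times[u,v])=\sup_{(t_i)\in\mathcal{D}([s,t]),\,(t'_j)\in\mathcal{D}([u,v])}\Big(\sum_{t'_j}\Big(\sum_{t_i}\Big|R\tbinom{t_i,t_{i+1}}{t'_j,t'_{j+1}}\Big|^{\gamma}\Big)^{\rho/\gamma}\Big)^{1/\rho}.$$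 *)

(* Defs.v *)
From HB Require Import structures.
From mathcomp Require Import all_boot all_order all_algebra.
From mathcomp Require Import all_classical all_reals all_analysis.

Set Implicit Arguments.
Unset Strict Implicit.
Unset Printing Implicit Defensive.

Import Order.TTheory GRing.Theory Num.Theory.
Import numFieldNormedType.Exports.

Local Open Scope classical_set_scope.
Local Open Scope ring_scope.

(* Dissections are those of the library: [itv_partition a b s] says that
   a < s_0 < s_1 < ... is an increasing sequence whose last term is b, so the
   points of the dissection are [a :: s] and there are [size s] intervals. *)

Section variation.
Variable R : realType.
Implicit Types (a b p : R) (f : R -> R) (K : R -> R -> R).

(* No outer exponent 1/p: this is the p-th power of the p-variation seminorm. *)
Definition p_variation_sum p a b f (s : seq R) : R :=
  let F := f \o nth b (a :: s) in
  \sum_(0 <= i < size s) `|F i.+1 - F i| `^ p.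

Definition p_variation p a b f : \bar R :=
  ereal_sup [set (p_variation_sum p a b f s)%:E | s in itv_partition a b].

Definition finite_p_variation p a b f : Prop := (p_variation p a b f < +oo)%E.

Definition rect_incr K (s t u v : R) : R := K s u - K s v - K t u + K t v.

(* [s1] dissects [a, b] (first argument of K, inner sum, exponent gamma) and
   [s2] dissects [c, d] (second argument, outer sum, exponent rho). *)
Definition mixed_variation_sum (gamma rho : R) K (a b c d : R)
    (s1 s2 : seq R) : R :=
  let x := nth b (a :: s1) in
  let y := nth d (c :: s2) in
  (\sum_(0 <= j < size s2)
     (\sum_(0 <= i < size s1)
        `|rect_incr K (x i) (x i.+1) (y j) (y j.+1)| `^ gamma)
       `^ (rho / gamma)) `^ rho^-1.

Definition mixed_variation (gamma rho : R) K (a b c d : R) : \bar R :=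
  ereal_sup [set (mixed_variation_sum gamma rho K a b c d s1 s2)%:E
            | s1 in itv_partition a b & s2 in itv_partition c d].

End variation.

Section gaussian_process.
Context (d : measure_display) (Omega : measurableType d) (R : realType).
Variable P : probability Omega R.

(* Degenerate (constant) laws count as Gaussian. They are treated apart because
   [normal_prob m 0] is by convention the uniform law on [0, 1]. *)
Definition gaussian_law (Y : Omega -> R) : Prop :=
  exists m sigma : R, 0 <= sigma /\
    forall A : set R, measurable A ->
      pushforward P Y A = if sigma == 0 then \d_m A else normal_prob m sigma A.

(* Processes are indexed by the whole of R for convenience; only the times in
   [0, T] are ever used. *)
Variables (T : R) (X : R -> {RV P >-> R}).

Definition process_span : set (Omega -> R) :=
  [set Y | exists (n : nat) (a t : 'I_n -> R),
     (forall i, t i \in `[0, T]) /\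
     Y = (fun w => \sum_(i < n) a i * X (t i) w)].

Definition gaussian_process : Prop :=
  forall Y, process_span Y -> gaussian_law Y.

Definition centered_process : Prop :=
  forall t : R, t \in `[0, T] -> ('E_P[X t] = 0)%E.

Definition continuous_process : Prop :=
  {ae P, forall w, {within `[0, T], continuous (fun t : R => X t w)}}.

Definition covariance_function (s t : R) : R :=
  fine ('E_P[(fun w => X s w * X t w)%R])%E.

Definition process_L2_closure : set {RV P >-> R} :=
  [set Z | forall e : R, 0 < e -> exists2 Y, process_span Y &
     ('N[P]_2%:E[EFin \o (Z \- Y)%R] < e%:E)%E].

(* The underlying set of the Cameron-Martin space; functions are constrained
   on [0, T] only. *)
Definition cameron_martin : set (R -> R) :=
  [set h | exists2 Z, process_L2_closure Z &
     forall t : R, t \in `[0, T] -> (h t)%:E = ('E_P[(fun w => Z w * X t w)%R])%E].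

End gaussian_process.

(* Main.v *)
Require Import Defs.
From HB Require Import structures.
From mathcomp Require Import all_boot all_order all_algebra.
From mathcomp Require Import all_classical all_reals all_analysis.
From mathcomp Require Import measurable_realfun.
From mathcomp Require Import lra ring zify.

Set Implicit Arguments.
Unset Strict Implicit.
Unset Printing Implicit Defensive.

Import Order.TTheory GRing.Theory Num.Theory.
Import numFieldNormedType.Exports.
Import HBNNSimple.

Local Open Scope classical_set_scope.
Local Open Scope ring_scope.

(* Let v(s, t) be the variance of X_t - X_s. It is a diagonal term of the inner
   sums of the mixed (1, rho)-variation, so \sum v(t_i, t_(i+1)) ^ rho is bounded
   over dissections and v(s, t) ^ rho <= F t - F s for an increasing F. In the
   clock F the process is 1/(2 rho)-Hoelder in L^2; Gaussian tails,
   Borel-Cantelli and chaining along 2^-n-nets for F make the sample paths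
   1/p-Hoelder in this clock for every p > 2 rho, hence of finite p-variation.
   For h_t = E[Z X_t], duality reduces the q-variation of h to the variance of
   \sum b_i (X_(t_(i+1)) - X_(t_i)), which the symmetry of the covariance and
   Young's inequality bound by the mixed variation. Since
   1 / q = 1 / (2 rho) + 1 / 2 > 3 / 4, the exponent p = 4 is admissible. *)

(** * Controls, nets and chaining *)

(** The default of [nth] changes from [b] to [c]; every index read is in range, so the values
    agree. *)
Lemma sum_itv_partition_rcons (R : realType) (g : R -> R -> R) (a b c : R)
    (s : seq R) : itv_partition a b s ->
  \sum_(0 <= i < size (rcons s c))
     g (nth c (a :: rcons s c) i) (nth c (a :: rcons s c) i.+1) =
  \sum_(0 <= i < size s) g (nth b (a :: s) i) (nth b (a :: s) i.+1) + g b c.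
Proof.
move=> [_ /eqP sb]; rewrite size_rcons big_nat_recr//=; congr (_ + g _ _).
- apply: eq_big_nat => i /andP[_ ilts]; rewrite -rcons_cons !nth_rcons/=.
  rewrite ltnS (ltnW ilts) ilts; congr (g _ _); last exact: set_nth_default.
  by apply: set_nth_default => /=; rewrite ltnS ltnW.
- by rewrite -rcons_cons nth_rcons/= ltnSn -sb nth_last.
- by rewrite nth_rcons ltnn eqxx.
Qed.

(* The control is the variation function t |-> sup over dissections of [a, t],
   plus t - a to make it strictly increasing. *)
Lemma exists_control (R : realType) (g : R -> R -> R) (a b M : R) :
  a < b -> (forall s t, 0 <= g s t) ->
  (forall s, itv_partition a b s ->
    \sum_(0 <= i < size s) g (nth b (a :: s) i) (nth b (a :: s) i.+1) <= M) ->
  exists F : R -> R,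
    [/\ forall t, a <= t <= b -> 0 <= F t <= M + (b - a),
        forall s t, a <= s -> s < t -> t <= b -> g s t <= F t - F s &
        forall s t, a <= s -> s < t -> t <= b -> t - s <= F t - F s].
Proof.
move=> ab g0 gM.
pose S c s := \sum_(0 <= i < size s) g (nth c (a :: s) i) (nth c (a :: s) i.+1).
have S0 c s : 0 <= S c s by apply: sumr_ge0.
have SM t s : t <= b -> itv_partition a t s -> S t s <= M.
  rewrite le_eqVlt => /predU1P[->|tb] ats; first exact: gM.
  have abs : itv_partition a b (rcons s b).
    by rewrite -cats1; apply: itv_partition_cat ats _; exact: itv_partition1.
  apply: le_trans (gM _ abs); rewrite (sum_itv_partition_rcons _ _ ats).
  by rewrite lerDl.
have part t : a <= t -> exists s, itv_partition a t s.
  rewrite le_eqVlt => /predU1P[<-|alt]; first by exists [::]; split => //=.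
  by exists [:: t]; exact: itv_partition1.
pose A t := [set S t s | s in itv_partition a t].
have supA t : a <= t -> t <= b -> has_sup (A t).
  move=> alt tb; split; first by have [s ps] := part _ alt; exists (S t s); exists s.
  by exists M => _ [s ps <-]; exact: SM.
have supD s t : a <= s -> s < t -> t <= b -> sup (A s) + g s t <= sup (A t).
  move=> as_ st tb; rewrite -lerBrDr; apply: ge_sup.
    by have [l pl] := part _ as_; exists (S s l); exists l.
  move=> _ [l pl <-]; rewrite lerBrDr -(sum_itv_partition_rcons _ _ pl).
  apply: ub_le_sup; first by case: (supA t) => //; rewrite (le_trans as_)// ltW.
  exists (rcons l t) => //.
  by rewrite -cats1; apply: itv_partition_cat pl _; exact: itv_partition1.
exists (fun t => sup (A t) + (t - a)); split.
- move=> t /andP[alt tb]; have [A0 Aub] := supA _ alt tb.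
  have [s ps] := part _ alt; apply/andP; split.
    rewrite addr_ge0 ?subr_ge0// (le_trans (S0 t s))//; apply: ub_le_sup => //.
    by exists s.
  rewrite lerD ?lerB//; apply: ge_sup => // _ [l pl <-]; exact: SM.
- move=> s t as_ st tb; have := supD s t as_ st tb; lra.
- move=> s t as_ st tb; have := supD s t as_ st tb; have := g0 s t; lra.
Qed.

(** A fine net point reaches level [n] through one neighbour per level, at a total cost of
    [theta ^+ n / (1 - theta)], a geometric series. For [s] and [t], descend from [s] to [u] in
    [U n] and from [t] to [v] in [U n.+1]: then [F u] and [F v] differ by at most (1 + 1 + 1/2)
    2^-n, whence the factor 3 in the hypothesis on links. The 3 in the conclusion counts the two
    descents and the link. *)
Lemma chaining (R : realType) (F x : R -> R) (U : nat -> seq R) (theta : R)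
    (n0 : nat) :
  0 < theta < 1 ->
  (forall n, {subset U n <= U n.+1}) ->
  (forall m n t, t \in U m -> exists2 u, u \in U n & `|F t - F u| <= 2^-1 ^+ n) ->
  (forall n u v, (n0 <= n)%N -> u \in U n -> v \in U n.+1 ->
     `|F u - F v| <= 3 * 2^-1 ^+ n -> `|x u - x v| <= theta ^+ n) ->
  forall n m s t, (n0 <= n)%N -> s \in U m -> t \in U m ->
    `|F s - F t| <= 2^-1 ^+ n -> `|x s - x t| <= 3 / (1 - theta) * theta ^+ n.
Proof.
move=> /andP[t0 t1] UU net step.
have U_le m j : {subset U m <= U (m + j)%N}.
  by elim: j => [|j IH] u; rewrite ?addn0// => /IH; rewrite addnS; exact: UU.
have p2 n : 0 < (2^-1 : R) ^+ n by rewrite exprn_gt0// invr_gt0.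
have p2S n : (2^-1 : R) ^+ n.+1 = 2^-1 ^+ n / 2 by rewrite exprS mulrC.
have pt n : 0 < theta ^+ n by rewrite exprn_gt0.
have one_le : 1 <= (1 - theta)^-1 by rewrite invf_ge1 ?subr_gt0//; lra.
have onet : 1 - theta != 0 by rewrite gt_eqF// subr_gt0.
have chain j : forall n t u, (n0 <= n)%N -> t \in U (n + j)%N -> u \in U n ->
    `|F t - F u| <= 2^-1 ^+ n -> `|x t - x u| <= theta ^+ n / (1 - theta).
  elim: j => [|j IH] n t u n0n tU uU Ftu.
    rewrite addn0 in tU; rewrite distrC (le_trans (step n u t _ _ _ _))//.
    - exact: UU.
    - by rewrite distrC (le_trans Ftu)// ler_peMl ?(ltW (p2 n))//; lra.
    - by rewrite ler_peMr// ltW.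
  have [v vU Ftv] := net _ n.+1 _ tU.
  have xuv : `|x u - x v| <= theta ^+ n.
    apply: step => //; rewrite p2S in Ftv; have := p2 n.
    move: Ftu Ftv; rewrite !ler_norml => /andP[? ?] /andP[? ?] ?.
    by apply/andP; split; lra.
  have xtv : `|x t - x v| <= theta ^+ n.+1 / (1 - theta).
    by apply: IH => //; [exact: leq_trans (leqnSn n)|rewrite addSnnS].
  have -> : theta ^+ n / (1 - theta) = theta ^+ n.+1 / (1 - theta) + theta ^+ n.
    by rewrite exprS; field.
  rewrite (le_trans (ler_distD (x v) _ _))// lerD// distrC//.
move=> n m s t n0n sU tU Fst.
have [u uU Fsu] := net _ n _ sU; have [v vU Ftv] := net _ n.+1 _ tU.
(* Since [U m] is contained in [U (n + m)], the levels [n] and [m] need not be compared. *)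
have xsu : `|x s - x u| <= theta ^+ n / (1 - theta).
  by apply: (chain m) => //; rewrite addnC; exact: U_le.
have xtv : `|x t - x v| <= theta ^+ n.+1 / (1 - theta).
  apply: (chain m) => //; first exact: leq_trans (leqnSn n).
  by rewrite addnC; exact: U_le.
have xuv : `|x u - x v| <= theta ^+ n.
  apply: step => //; rewrite p2S in Ftv; have := p2 n.
  move: Fsu Fst Ftv; rewrite !ler_norml => /andP[? ?] /andP[? ?] /andP[? ?] ?.
  by apply/andP; split; lra.
have tS : theta ^+ n.+1 / (1 - theta) <= theta ^+ n / (1 - theta).
  rewrite ler_pM2r ?invr_gt0 ?subr_gt0// exprS ler_piMl ?(ltW (pt n))//; exact: ltW.
have tn : theta ^+ n <= theta ^+ n / (1 - theta) by rewrite ler_peMr// ltW.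
have -> : 3 / (1 - theta) * theta ^+ n = theta ^+ n / (1 - theta) *+ 3.
  by rewrite -mulr_natl; ring.
move: xsu xtv xuv; move: (theta ^+ n / (1 - theta)) (theta ^+ n.+1 / _) tS tn => B C.
move=> CB tB; rewrite !ler_norml => /andP[? ?] /andP[? ?] /andP[? ?].
by apply/andP; split; lra.
Qed.

(** [F] may jump, so the dyadic values k / 2^n need not be attained. Instead one time is chosen in
    each nonempty cell k <= 2^n F < k + 1, and the levels up to [n] are accumulated to make the nets
    nested. *)
Lemma exists_nets (R : realType) (F : R -> R) (a b M : R) : a < b ->
  (forall t, a <= t <= b -> 0 <= F t <= M) ->
  exists2 U : nat -> seq R,
    [/\ forall n, {subset U n <= U n.+1},
        forall n u, u \in U n -> a <= u <= b &
        forall n t, a <= t <= b -> exists2 u, u \in U n & `|F t - F u| <= 2^-1 ^+ n]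
    & exists N : nat, forall n, (size (U n) <= N * 2 ^ n)%N.
Proof.
move=> ab FM.
pose Q n k t := (a <= t <= b) && (k%:R <= 2 ^+ n * F t < k.+1%:R).
(* An empty cell gets the default [a], which keeps every net point in [a, b]. *)
pose r n k := if pselect (exists t, Q n k t) is left e then projT1 (cid e) else a.
have rab n k : a <= r n k <= b.
  rewrite /r; case: pselect => [e|_]; last by rewrite lexx ltW.
  by case: cid => t /= /andP[].
pose N := (Num.truncn M).+1.
pose L n := [seq r n k | k <- iota 0 (N * 2 ^ n)].
have sL n : size (L n) = (N * 2 ^ n)%N by rewrite size_map size_iota.
pose U n := flatten [seq L m | m <- iota 0 n.+1].
have US n : U n.+1 = U n ++ L n.+1.
  by rewrite /U -[in LHS]addn1 iotaD map_cat flatten_cat/= cats0.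
have LU n : {subset L n <= U n}.
  case: n => [|n] u; first by rewrite /U/= cats0.
  by rewrite US mem_cat => ->; rewrite orbT.
exists U; last first.
  (* Level m contributes N 2^m points, and 1 + 2 + ... + 2^n < 2 * 2^n. *)
  exists (2 * N)%N; elim=> [|n IH]; first by rewrite /U/= cats0 size_map size_iota expn0; lia.
  by rewrite US size_cat sL expnS; nia.
split.
- by move=> n u uU; rewrite US mem_cat uU.
- move=> n u /flattenP[_ /mapP[m _ ->] /mapP[k _ ->]]; exact: rab.
move=> n t tab.
have /andP[Ft0 FtM] := FM _ tab.
have Ftn : 0 <= 2 ^+ n * F t by rewrite mulr_ge0// exprn_ge0.
pose k := Num.truncn (2 ^+ n * F t).
have kP : Q n k t by rewrite /Q tab/= /k truncn_itv.
have kN : (k < N * 2 ^ n)%N.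
  have : (k%:R : R) < (N * 2 ^ n)%:R.
    have /andP[_ /andP[kl _]] := kP.
    rewrite (le_lt_trans kl)// natrM natrX mulrC ltr_pM2r ?exprn_gt0//.
    by rewrite (le_lt_trans FtM)// truncnS_gt.
  by rewrite ltr_nat.
exists (r n k); first by apply/LU/mapP; exists k => //; rewrite mem_iota.
have : Q n k (r n k).
  by rewrite /r; case: pselect => [e|[]]; [case: cid|exists t].
move: kP => /andP[_ /andP[k1 k2]] /andP[_ /andP[k3 k4]].
rewrite exprVn -(ler_pM2l (_ : 0 < 2 ^+ n)) ?exprn_gt0// mulfV ?expf_neq0//.
rewrite -[X in X * _]ger0_norm ?exprn_ge0// -normrM mulrBr ler_norml.
by rewrite -natr1 in k2 k4; apply/andP; split; lra.
Qed.

Lemma within_itv_continuous_dist (R : realType) (a b t e : R) (x : R -> R) :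
  {within `[a, b], continuous x} -> a <= t <= b -> 0 < e ->
  exists2 d, 0 < d & forall u, a <= u <= b -> `|t - u| < d -> `|x t - x u| < e.
Proof.
move=> /subspace_continuousP cx tab e0.
have /cvgrPdist_lt/(_ e e0) := cx t tab.
rewrite /within/= => -[d /= d0 dP]; exists d => // u uab tu.
exact: dP.
Qed.

(** The nets are dense in time because [F] grows at least as fast as time. As [F] may jump, [s] and
    [t] are approximated by net points between them: monotonicity then keeps the increment of [F] at
    most [r], and continuity of [x] passes to the limit. *)
Lemma dense_net_increments (R : realType) (F x : R -> R) (a b c r : R)
    (U : nat -> seq R) :
  {within `[a, b], continuous x} ->
  (forall n u, u \in U n -> a <= u <= b) ->
  (forall s t, a <= s -> s < t -> t <= b -> t - s <= F t - F s) ->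
  (forall n t, a <= t <= b -> exists2 u, u \in U n & `|F t - F u| <= 2^-1 ^+ n) ->
  (forall m n s t, s \in U m -> t \in U n -> `|F s - F t| <= r ->
    `|x s - x t| <= c) ->
  forall s t, a <= s -> s < t -> t <= b -> F t - F s <= r -> `|x t - x s| <= c.
Proof.
move=> cx Uab Fid net xU s t as_ st tb Fst.
have near_net v e : a <= v <= b -> 0 < e -> exists n u, [/\ u \in U n & `|v - u| < e].
  move=> vab e0; have : `|2^-1 : R| < 1.
    by rewrite ger0_norm ?invr_ge0// invf_lt1//; lra.
  move=> /cvg_expr/cvgrPdist_lt/(_ e e0)[n _ /(_ n (leqnn n))] /=.
  rewrite sub0r normrN ger0_norm ?exprn_ge0 ?invr_ge0// => ne.
  have [u uU Fvu] := net n v vab; exists n, u; split => //.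
  apply: le_lt_trans ne; apply: le_trans Fvu.
  have := Uab _ _ uU => /andP[au ub]; case/andP: vab => av vb.
  have [uv|vu|->] := ltgtP u v; last by rewrite !subrr.
  - by rewrite ger0_norm ?subr_ge0 ?(ltW uv)// (le_trans (Fid _ _ au uv vb))// ler_norm.
  - rewrite distrC ger0_norm ?subr_ge0 ?(ltW vu)// distrC.
    by rewrite (le_trans (Fid _ _ av vu ub))// ler_norm.
have Fmono u v : a <= u -> u <= v -> v <= b -> F u <= F v.
  move=> au; rewrite le_eqVlt => /predU1P[->//|uv] vb.
  by have := Fid u v au uv vb; lra.
apply/ler_addgt0Pr => e e0; have e20 : 0 < e / 2 by rewrite divr_gt0.
have sab : a <= s <= b by rewrite as_/=; lra.
have tab : a <= t <= b by rewrite tb andbT; lra.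
have [d1 d10 Hs] := within_itv_continuous_dist cx sab e20.
have [d2 d20 Ht] := within_itv_continuous_dist cx tab e20.
(* Net points within [d] of [s + d] and [t - d] lie in (s, s + 2d) and (t - 2d, t). The quarter
   keeps them in order and within reach of [d1] and [d2]. *)
pose d := Num.min (Num.min d1 d2) (t - s) / 4.
have d0 : 0 < d by rewrite divr_gt0// !lt_min d10 d20 subr_gt0 st.
have dl : [/\ 4 * d <= d1, 4 * d <= d2 & 4 * d <= t - s].
  by rewrite /d mulrC divfK//; split; rewrite !ge_min lexx ?orbT.
case: dl => dd1 dd2 dst.
have [|n1 [u [uU su]]] := @near_net (s + d) d _ d0; first by apply/andP; split; lra.
have [|n2 [v [vU tv]]] := @near_net (t - d) d _ d0; first by apply/andP; split; lra.
move: su tv; rewrite !ltr_norml => /andP[? ?] /andP[? ?].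
have xsu : `|x s - x u| < e / 2.
  apply: Hs; first exact: Uab uU.
  by rewrite ltr_norml; apply/andP; split; lra.
have xtv : `|x t - x v| < e / 2.
  apply: Ht; first exact: Uab vU.
  by rewrite ltr_norml; apply/andP; split; lra.
have Fsu : F s <= F u by apply: Fmono; lra.
have Fvt : F v <= F t by apply: Fmono; lra.
have Fuv : F u <= F v by apply: Fmono; lra.
have xuv : `|x u - x v| <= c.
  by apply: (xU _ _ _ _ uU vU); rewrite ler_norml; apply/andP; split; lra.
move: xsu xtv xuv; rewrite !ltr_norml !ler_norml.
by move=> /andP[? ?] /andP[? ?] /andP[? ?]; apply/andP; split; lra.
Qed.

Lemma le_dyadic (R : realType) (n0 : nat) (d : R) : 0 < d <= 2^-1 ^+ n0 ->
  exists2 n, (n0 <= n)%N & 2^-1 ^+ n.+1 < d <= 2^-1 ^+ n.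
Proof.
move=> /andP[d0 dn0].
have /cvg_expr/cvgrPdist_lt/(_ d d0)[m _ /(_ m (leqnn m))] /= : `|2^-1 : R| < 1.
  by rewrite ger0_norm ?invr_ge0// invf_lt1//; lra.
rewrite sub0r normrN ger0_norm ?exprn_ge0 ?invr_ge0// => md.
have ex : exists n, 2^-1 ^+ n < d by exists m.
case: (ex_minnP ex) => [[|n]] nd nmin.
  have : (2^-1 : R) ^+ n0 <= 1 by rewrite exprn_ile1 ?invr_ge0// invf_le1//; lra.
  by rewrite expr0 in nd; lra.
exists n; last first.
  by rewrite nd/= leNgt; apply/negP => /nmin; rewrite ltnn.
rewrite -ltnS ltnNge; apply/negP => nn0.
have := lt_le_trans nd dn0; apply/negP; rewrite -leNgt.
by rewrite ler_wiXn2l ?invr_ge0// invf_le1//; lra.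
Qed.

(* By [dense_net_increments] the p-th powers of short increments are bounded by
   increments of F; long ones are bounded because x is. *)
Lemma control_finite_p_variation (R : realType) (F x : R -> R) (a b p : R)
    (n0 : nat) (K : R) :
  a < b -> 0 < p -> 0 <= K ->
  {within `[a, b], continuous x} ->
  (forall s t, a <= s -> s < t -> t <= b -> F s < F t) ->
  (forall n s t, (n0 <= n)%N -> a <= s -> s < t -> t <= b ->
    F t - F s <= 2^-1 ^+ n -> `|x t - x s| <= K * (2^-1 `^ p^-1) ^+ n) ->
  finite_p_variation p a b x.
Proof.
move=> ab p0 K0 cx Fst xF.
have pn0 : p != 0 by rewrite gt_eqF.
have [c1 c1I ub] := EVT_max (ltW ab) cx.
have [c2 _ lb] := EVT_min (ltW ab) cx.
(* The first entry is for short increments: the p-th power of the Hoelder bound is K^p 2^-n, and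
   2^-n < 2 (F t - F s) for the dyadic scale of the increment. The second is for F t - F s > 2^-n0,
   with the oscillation of [x]. *)
pose C := Num.max (2 * K `^ p) ((x c1 - x c2) `^ p * 2 ^+ n0).
have main s t : a <= s -> s < t -> t <= b -> `|x t - x s| `^ p <= C * (F t - F s).
  move=> as_ st tb; have Fd : 0 < F t - F s by rewrite subr_gt0 Fst.
  have [Fn0|Fn0] := leP (F t - F s) (2^-1 ^+ n0).
    have [n n0n /andP[nd dn]] := le_dyadic (introT andP (conj Fd Fn0)).
    have h := xF n s t n0n as_ st tb dn.
    rewrite (@le_trans _ _ (2 * K `^ p * (F t - F s)))//; last first.
      by rewrite ler_pM2r// /C le_max lexx.
    have t0 : 0 <= (2^-1 : R) `^ p^-1 by exact: powR_ge0.
    rewrite (@le_trans _ _ ((K * (2^-1 `^ p^-1) ^+ n) `^ p))//.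
      by rewrite ge0_ler_powR ?nnegrE ?(ltW p0)// mulr_ge0// exprn_ge0.
    rewrite powRM// ?exprn_ge0// -powR_mulrn// -!powRrM.
    rewrite (_ : p^-1 * (n%:R * p) = n%:R); last by field.
    rewrite powR_mulrn ?invr_ge0// [2 * _]mulrC -mulrA ler_wpM2l ?powR_ge0//.
    by rewrite exprS in nd; lra.
  rewrite (@le_trans _ _ ((x c1 - x c2) `^ p * 2 ^+ n0 * (F t - F s)))//; last first.
    by rewrite ler_pM2r// /C le_max lexx orbT.
  apply: (@le_trans _ _ ((x c1 - x c2) `^ p)); last first.
    rewrite -mulrA ler_peMr ?powR_ge0//.
    by rewrite mulrC -ler_pdivrMr ?exprn_gt0// div1r -exprVn ltW.
  rewrite ge0_ler_powR ?nnegrE ?(ltW p0)//.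
    by rewrite subr_ge0; apply: lb.
  have sI : s \in `[a, b] by rewrite in_itv/=; apply/andP; split; lra.
  have tI : t \in `[a, b] by rewrite in_itv/=; apply/andP; split; lra.
  have := ub _ sI; have := ub _ tI; have := lb _ sI; have := lb _ tI.
  by rewrite ler_norml => ? ? ? ?; apply/andP; split; lra.
rewrite /finite_p_variation /p_variation.
apply: (@le_lt_trans _ _ (C * (F b - F a))%:E); last by rewrite ltry.
apply: ge_ereal_sup => _ [s ps <-]; rewrite lee_fin /p_variation_sum.
have [sp /eqP sb] := ps.
have -> : F b - F a = \sum_(0 <= i < size s)
    (F (nth b (a :: s) i.+1) - F (nth b (a :: s) i)).
  rewrite telescope_sumr//= -[in LHS]sb; congr (F _ - _).
  by rewrite (last_nth b).
rewrite mulr_sumr; apply: ler_sum_nat => i /= ilts; apply: main.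
- by apply: itv_partition_nth_ge => //; rewrite ltnS ltnW.
- exact: (pathP _ sp).
- exact: (itv_partition_nth_le (m := i.+1) _ ps).
Qed.

(** * Gaussian laws *)

(** The left-hand side is a supremum over simple functions below [f], so it suffices to apply the
    density formula to the level sets of each one. Upper bounds on Gaussian integrals use this
    direction. *)
Lemma ge0_integral_density (d : measure_display) (T : measurableType d)
    (R : realType) (nu mu : {measure set T -> \bar R}) (w : T -> R)
    (f : T -> \bar R) :
  measurable_fun [set: T] w -> (forall x, 0 <= w x) ->
  (forall A, measurable A -> nu A = \int[mu]_(x in A) (w x)%:E)%E ->
  (forall x, (0 <= f x)%E) -> measurable_fun [set: T] f ->
  (\int[nu]_x f x <= \int[mu]_x (f x * (w x)%:E))%E.
Proof.
move=> mw w0 nuE f0 mf; rewrite [leLHS]ge0_integralTE//.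
apply: ge_ereal_sup => _ [h /= hf <-].
pose t k x := (k * \1_(h @^-1` [set k]) x * w x)%:E : \bar R.
have mt k : measurable_fun setT (t k).
  by apply/measurable_EFinP/measurable_funM => //; exact: measurable_funM.
have hk0 k x : 0 <= k * \1_(h @^-1` [set k]) x.
  by have := nnfun_muleindic_ge0 h k x; rewrite -EFinM lee_fin.
have t0 k x : (0 <= t k x)%E by rewrite lee_fin mulr_ge0.
have -> : sintegral nu h = (\int[mu]_x (h x * w x)%:E)%E.
  under [RHS]eq_integral => x _.
    rewrite fimfunE mulr_fsuml -fsumEFin//; over.
  rewrite (ge0_integral_fsum _ measurableT mt (fun k x _ => t0 k x))// sintegralE.
  apply: eq_fsbigr => k; rewrite inE => -[y _ yk].
  rewrite nuE// integral_mkcond -ge0_integralZl//=.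
  - apply: eq_integral => x _; rewrite /t epatch_indic/= -!EFinM; congr EFin; ring.
  - by apply/(measurable_restrictT _ _).1/measurable_EFinP => //; exact: measurable_funTS.
  - by move=> x _; apply: erestrict_ge0 => z _; rewrite lee_fin.
  - by rewrite lee_fin -yk.
apply: ge0_le_integral => //.
- by move=> x _; rewrite lee_fin mulr_ge0.
- by apply/measurable_EFinP/measurable_funM.
- by apply: emeasurable_funM => //; exact/measurable_EFinP.
- by move=> x _; rewrite EFinM lee_wpmul2r// lee_fin.
Qed.

(** At m + 2 s z the Gaussian exponent is -2 z^2. One half is kept as [expR (- z ^+ 2)], the other
    is the exponent for the deviation sqrt 2 s. The peaks have ratio sqrt 2, rounded up to 2. *)
Lemma normal_pdf_split (R : realType) (m s z : R) : 0 < s ->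
  normal_pdf m s (m + 2 * s * z) <=
  2 * expR (- z ^+ 2) * normal_pdf m (Num.sqrt 2 * s) (m + 2 * s * z).
Proof.
move=> s0.
have q0 : 0 < Num.sqrt 2 * s :> R by rewrite mulr_gt0// sqrtr_gt0.
rewrite !normal_pdfE ?gt_eqF//.
have sq2 : Num.sqrt 2 ^+ 2 = 2 :> R by rewrite sqr_sqrtr.
have -> : normal_peak (Num.sqrt 2 * s) = normal_peak s / Num.sqrt 2.
  rewrite /normal_peak exprMn sq2 -!mulrA -mulrnAr Num.Theory.sqrtrM// invfM mulrC.
  by [].
rewrite /normal_fun exprMn sq2 addrAC subrr add0r.
have -> : expR (- (2 * s * z) ^+ 2 / (s ^+ 2 *+ 2)) =
    expR (- z ^+ 2) * expR (- (2 * s * z) ^+ 2 / (2 * s ^+ 2 *+ 2)).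
  by rewrite -expRD; congr expR; field; rewrite gt_eqF.
have q1 : Num.sqrt 2 <= 2 :> R.
  by rewrite -ler_sqr ?nnegrE ?sqrtr_ge0// sq2; lra.
have q2 : 0 < Num.sqrt 2 :> R by rewrite sqrtr_gt0.
have := normal_peak_ge0 s; move: (normal_peak s) => k k0.
have := expR_ge0 (- z ^+ 2); move: (expR (- z ^+ 2)) => u u0.
have := expR_ge0 (- (2 * s * z) ^+ 2 / (2 * s ^+ 2 *+ 2)).
move: (expR (- (2 * s * z) ^+ 2 / (2 * s ^+ 2 *+ 2))) => v v0.
have -> : 2 * u * (k / Num.sqrt 2 * v) = k * (u * v) * (2 / Num.sqrt 2) by ring.
by rewrite ler_peMr ?mulr_ge0// ler_pdivlMr// mul1r.
Qed.

(** By [normal_pdf_split] the growth [expR (z ^+ 2)] cancels, leaving 2 B times a normal density of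
    total mass 1. *)
Lemma normal_integral_le (R : realType) (m s B : R) (g : R -> R) : 0 < s ->
  measurable_fun [set: R] g -> (forall x, 0 <= g x) ->
  (forall z, g (m + 2 * s * z) <= B * expR (z ^+ 2)) ->
  (\int[normal_prob m s]_x (g x)%:E <= (2 * B)%:E)%E.
Proof.
move=> s0 mg g0 gB.
have B0 : 0 <= B.
  by have := le_trans (g0 _) (gB 0); rewrite pmulr_lge0// expR_gt0.
apply: le_trans (ge0_integral_density (mu := lebesgue_measure)
  (@measurable_normal_pdf _ m s) (normal_pdf_ge0 m s) _ _ _) _ => //.
  exact/measurable_EFinP.
have q0 : 0 < Num.sqrt 2 * s :> R by rewrite mulr_gt0// sqrtr_gt0.
rewrite -[leRHS]mule1 -(integral_normal_pdf m (Num.sqrt 2 * s)).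
rewrite -ge0_integralZl//; last 3 first.
- by apply/measurable_EFinP; exact: measurable_normal_pdf.
- by move=> x _; rewrite lee_fin normal_pdf_ge0.
- by rewrite lee_fin mulr_ge0.
apply: ge0_le_integral => //.
- by move=> x _; rewrite -EFinM lee_fin mulr_ge0// normal_pdf_ge0.
- by apply/measurable_EFinP/measurable_funM => //; exact: measurable_normal_pdf.
- by apply/measurable_EFinP/measurable_funM => //; exact: measurable_normal_pdf.
move=> x _; rewrite -!EFinM lee_fin.
have -> : x = m + 2 * s * ((x - m) / (2 * s)) by field; rewrite gt_eqF.
move: ((x - m) / (2 * s)) => z.
apply: le_trans (ler_wpM2l (g0 _) (normal_pdf_split m z s0)) _.
apply: le_trans (ler_wpM2r _ (gB z)) _.
  by rewrite mulr_ge0 ?normal_pdf_ge0// mulr_ge0 ?expR_ge0.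
rewrite expRN le_eqVlt; apply/orP; left; apply/eqP.
by field; rewrite gt_eqF ?expR_gt0.
Qed.

(** The interval has length 2 r, and the density is at most 1 / sqrt (2 pi s^2) <= 1 / (2 s) because
    pi >= 2. A lower bound on the mass thus becomes an upper bound on [s]. *)
Lemma normal_prob_itv_le (R : realType) (m s r : R) : 0 < s -> 0 < r ->
  (normal_prob m s `[(- r)%R, r]%classic <= (r / s)%R%:E)%E.
Proof.
move=> s0 r0; rewrite /normal_prob.
apply: (@le_trans _ _ (\int[lebesgue_measure]_(x in `[(- r)%R, r]) (normal_peak s)%:E)%E).
  apply: ge0_le_integral => //.
  - by move=> x _; rewrite lee_fin normal_pdf_ge0.
  - by apply/measurable_EFinP/measurable_funTS; exact: measurable_normal_pdf.
  - by move=> x _; rewrite lee_fin normal_pdf_ub// gt_eqF.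
rewrite integral_cst//= lebesgue_measure_itv/= lte_fin ifT; last by lra.
rewrite -EFinB -EFinM lee_fin opprK /normal_peak ler_pdivlMr// -[leLHS]mulrA.
have y0 : 0 < Num.sqrt (s ^+ 2 * pi *+ 2) by rewrite -invr_gt0 normal_peak_gt0// gt_eqF.
rewrite ler_pdivrMl//.
have : 2 * s <= Num.sqrt (s ^+ 2 * pi *+ 2).
  rewrite -ler_sqr ?nnegrE ?sqrtr_ge0 ?mulr_ge0 ?(ltW s0)//.
  rewrite sqr_sqrtr; last by rewrite mulrn_wge0// mulr_ge0 ?sqr_ge0// pi_ge0.
  have := pi_ge2 R; have := sqr_ge0 s; nra.
nra.
Qed.

Lemma measurable_norm_ge (d : measure_display) (Omega : measurableType d)
    (R : realType) (Y : {mfun Omega >-> R}) (lambda : R) :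
  measurable [set w | lambda <= `|Y w|].
Proof.
have mN : measurable_fun [set: Omega] (fun w => `|Y w|) by exact: measurableT_comp.
have := mN measurableT _ (measurable_itv `[lambda, +oo[); rewrite setTI.
by congr measurable; apply/seteqP; split => w /=; rewrite in_itv/= andbT.
Qed.

Lemma markov_moment (d : measure_display) (Omega : measurableType d)
    (R : realType) (P : probability Omega R) (Y : {RV P >-> R}) (k : nat)
    (lambda : R) : 0 < lambda ->
  (P [set w | (lambda <= `|Y w|)%R] <=
    (lambda ^- k.*2)%:E * \int[P]_w (Y w ^+ k.*2)%:E)%E.
Proof.
move=> l0; have lk0 : 0 < lambda ^+ k.*2 by rewrite exprn_gt0.
rewrite -lee_pdivrMl ?invr_gt0// invrK.
apply: le_trans (@markov _ _ _ P Y (fun x => x ^+ k.*2) lambda l0 _ _ _) _.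
- exact: measurable_funX.
- by move=> r r0; rewrite exprn_ge0.
- by move=> x y; rewrite !nnegrE => x0 y0 xy; rewrite lerXn2r.
rewrite unlock le_eqVlt; apply/orP; left; apply/eqP; apply: eq_integral => w _ /=.
by rewrite -muln2 mulnC !exprM real_normK// num_real.
Qed.

(* Since [Y = m + 2 s Z] with [expR (Z ^+ 2)] of bounded expectation, growth at
   most [expR (z ^+ 2)] controls expectations; conversely a Gaussian whose
   second moment is small gives mass at least 3/4 to a short interval, hence has
   a high density and a small standard deviation. *)
Lemma gaussian_law_integral (d : measure_display) (Omega : measurableType d)
    (R : realType) (P : probability Omega R) (Y : {RV P >-> R}) :
  gaussian_law P Y -> exists m s : R,
  [/\ 0 <= s,
      forall (g : R -> R) B, measurable_fun [set: R] g -> (forall x, 0 <= g x) ->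
        (forall z, g (m + 2 * s * z) <= B * expR (z ^+ 2)) ->
        (\int[P]_w (g (Y w))%:E <= (2 * B)%:E)%E &
      forall r, 0 < r -> (\int[P]_w (Y w ^+ 2)%:E <= (r ^+ 2)%:E)%E -> s <= 3 * r].
Proof.
move=> [m [s [s0 law]]]; exists m, s; split => //.
- move=> g B mg g0 gB.
  have mY : @measurable_fun _ _ Omega (measurableTypeR R) setT Y.
    exact: (measurable_funPT Y : measurable_fun setT Y).
  have := ge0_integral_pushforward mY P measurableT (f := fun x => (g x)%:E).
  rewrite preimage_setT => <-; last 2 first.
  - exact/measurable_EFinP.
  - by move=> y _; rewrite lee_fin.
  have [sE|sN] := eqVneq s 0.
    rewrite (eq_measure_integral (\d_(m : measurableTypeR R))); last first.
      by move=> A mA _; rewrite -[LHS]/(pushforward P Y A) law// sE eqxx.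
    rewrite integral_dirac//; last exact/measurable_EFinP.
    rewrite diracT mul1e lee_fin.
    have := gB 0; rewrite mulr0 addr0 expr0n expR0 mulr1; have := g0 m; lra.
  rewrite (eq_measure_integral (normal_prob m s)); last first.
    by move=> A mA _; rewrite -[LHS]/(pushforward P Y A) law// (negbTE sN).
  by apply: normal_integral_le => //; rewrite lt_neqAle eq_sym sN.
move=> r r0 Y2; have r20 : 0 < 2 * r by rewrite mulr_gt0.
move: s0; rewrite le_eqVlt => /predU1P[<-|s0]; first by rewrite mulr_ge0// ltW.
have mI : measurable (`[(- (2 * r))%R, 2 * r]%classic : set R) by [].
(* Markov at height 2 r gives r^2 / (2 r)^2 = 1/4. The remaining mass 3/4 is at most 2 r / s, so s
   <= 8 r / 3. *)
have PI : (P [set w | (2 * r <= `|Y w|)%R] <= (4^-1)%:E)%E.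
  apply: le_trans (markov_moment Y 1 r20) _.
  apply: le_trans (lee_wpmul2l _ Y2) _; first by rewrite lee_fin invr_ge0 exprn_ge0// ltW.
  rewrite -EFinM lee_fin le_eqVlt; apply/orP; left; apply/eqP.
  by rewrite -[1.*2]/2%N; field; rewrite gt_eqF.
have mS := measurable_norm_ge Y (2 * r).
have : (1 - 4^-1 <= (2 * r) / s)%R.
  rewrite -lee_fin; apply: le_trans (normal_prob_itv_le m s0 r20).
  have := law _ mI; rewrite gt_eqF// => <-.
  apply: (@le_trans _ _ (P (~` [set w | (2 * r <= `|Y w|)%R]))).
    by rewrite probability_setC// EFinB leeB.
  rewrite le_measure// ?inE; [exact: measurableC|exact: measurable_funPTI|].
  move=> w /= /negP; rewrite -ltNge => /ltW; rewrite ler_norml.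
  by rewrite in_itv.
rewrite ler_pdivlMr//; lra.
Qed.

(** This places the process in L^2. The growth condition holds because (m + 2 s z)^2 <= 2 m^2 + 8
    s^2 z^2 and both 1 and z^2 are at most [expR (z ^+ 2)]. *)
Lemma gaussian_law_sqr_integral (d : measure_display) (Omega : measurableType d)
    (R : realType) (P : probability Omega R) (Y : {RV P >-> R}) :
  gaussian_law P Y -> (\int[P]_w (Y w ^+ 2)%:E < +oo)%E.
Proof.
move=> /gaussian_law_integral[m [s [s0 intY _]]].
apply: le_lt_trans (intY (fun x => x ^+ 2) (2 * m ^+ 2 + 8 * s ^+ 2) _ _ _) _.
- exact: measurable_funX.
- by move=> x; rewrite sqr_ge0.
- move=> z; have := expR_ge1Dx (z ^+ 2); have := sqr_ge0 z.
  have : (m + 2 * s * z) ^+ 2 <= 2 * m ^+ 2 + 8 * s ^+ 2 * z ^+ 2.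
    by have := sqr_ge0 (m - 2 * s * z); nra.
  have := sqr_ge0 m; have := sqr_ge0 s.
  move: (z ^+ 2) (m ^+ 2) (s ^+ 2) (expR _) => a b c e; nra.
- exact: ltry.
Qed.

(** Markov's inequality for the moment of order 2 (k + 1), which a Gaussian law bounds by a power of
    the second moment. The constant depends on [k] alone and so serves all increments at once. *)
Lemma gaussian_law_tail (d : measure_display) (Omega : measurableType d)
    (R : realType) (P : probability Omega R) (k : nat) :
  exists2 c : R, 0 <= c & forall (Y : {RV P >-> R}) (r lambda : R),
  gaussian_law P Y -> 0 < r -> 0 < lambda ->
  (\int[P]_w (Y w ^+ 2)%:E <= (r ^+ 2)%:E)%E ->
  (P [set w | (lambda <= `|Y w|)%R] <=
     (c * (r ^+ 2 / lambda ^+ 2) ^+ k.+1)%:E)%E.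
Proof.
(* Below [2 m^2 + 8 s^2 <= (2 * 146 + 8 * 9) r^2]; [K] is opaque because
   unification would unfold the numeral 364. *)
have [K [K0 KE]] : exists K : R, 0 <= K /\ K = 364 by exists 364; split; rewrite ?ler0n.
exists (2 * (K * k.+1%:R) ^+ k.+1); first by rewrite mulr_ge0// exprn_ge0// mulr_ge0.
move=> Y r lambda /gaussian_law_integral[m [s [s0 intY]]] + r0 l0 Y2.
move=> /(_ r r0 Y2) s3.
have s2 : s ^+ 2 <= 9 * r ^+ 2 by nra.
(* From m^2 <= 2 Y^2 + 2 (Y - m)^2 and E (Y - m)^2 <= 8 s^2 <= 72 r^2: 2 + 2 * 72 = 146. *)
have m2 : m ^+ 2 <= 146 * r ^+ 2.
  have : (\int[P]_w ((Y w - m) ^+ 2)%:E <= (2 * (4 * s ^+ 2))%:E)%E.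
    apply: (intY (fun x => (x - m) ^+ 2)).
    - by apply: measurable_funX; exact: measurable_funB.
    - by move=> x; rewrite sqr_ge0.
    - move=> z; rewrite addrAC subrr add0r !exprMn -[2 ^+ 2]/(2 * 2).
      have := expR_ge1Dx (z ^+ 2); have := sqr_ge0 z; have := sqr_ge0 s.
      move: (z ^+ 2) (s ^+ 2) (expR _) => a c e; nra.
  move=> Ym.
  have mY2 : measurable_fun setT (fun w => (Y w ^+ 2)%:E).
    by apply/measurable_EFinP; exact: measurable_funX.
  have mYm : measurable_fun setT (fun w => ((Y w - m) ^+ 2)%:E).
    by apply/measurable_EFinP; apply: measurable_funX; exact: measurable_funB.
  have : ((m ^+ 2)%:E <= 2%:E * (r ^+ 2)%:E + 2%:E * (2 * (4 * s ^+ 2))%:E)%E.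
    apply: (@le_trans _ _ (\int[P]_w
        (2%:E * (Y w ^+ 2)%:E + 2%:E * ((Y w - m) ^+ 2)%:E))%E).
      rewrite -[leLHS]mule1 -(probability_setT P) -integral_cst//.
      apply: ge0_le_integral => //.
      - by move=> w _; rewrite lee_fin sqr_ge0.
      - by apply: emeasurable_funD; apply: emeasurable_funM.
      - move=> w _; rewrite -!EFinM -EFinD lee_fin/=.
        by have := sqr_ge0 (Y w + (Y w - m)); nra.
    rewrite ge0_integralD//.
    - rewrite !ge0_integralZl//.
      + by rewrite leeD// lee_pmul2l.
      + by move=> w _; rewrite lee_fin sqr_ge0.
      + by move=> w _; rewrite lee_fin sqr_ge0.
    - by move=> w _; rewrite -EFinM lee_fin mulr_ge0// sqr_ge0.
    - exact: emeasurable_funM.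
    - by move=> w _; rewrite -EFinM lee_fin mulr_ge0// sqr_ge0.
    - exact: emeasurable_funM.
  rewrite -!EFinM -EFinD lee_fin; lra.
apply: le_trans (markov_moment Y k.+1 l0) _.
have : (\int[P]_w (Y w ^+ k.+1.*2)%:E <=
    (2 * ((K * k.+1%:R) ^+ k.+1 * (r ^+ 2) ^+ k.+1))%:E)%E.
  apply: (intY (fun x => x ^+ k.+1.*2)).
  - exact: measurable_funX.
  - by move=> x; rewrite -muln2 mulnC exprM exprn_ge0// sqr_ge0.
  move=> z; rewrite -muln2 mulnC exprM -exprMn.
  (* Sharing the exponential among the k + 1 factors reduces the bound to one square. There 1 + z^2
     <= (k + 1) exp (z^2 / (k + 1)), which is where the factor k + 1 of the constant arises. *)
  have -> : expR (z ^+ 2) = expR (z ^+ 2 / k.+1%:R) ^+ k.+1.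
    by rewrite -expRM_natl mulrC divfK// pnatr_eq0.
  have e0 : 0 <= K * k.+1%:R * r ^+ 2 * expR (z ^+ 2 / k.+1%:R).
    by rewrite mulr_ge0 ?expR_ge0// mulr_ge0 ?sqr_ge0// mulr_ge0.
  rewrite -exprMn lerXn2r ?nnegrE ?sqr_ge0//.
  have : (m + 2 * s * z) ^+ 2 <= K * r ^+ 2 * (1 + z ^+ 2).
    have := sqr_ge0 (m - 2 * s * z); have := sqr_ge0 z.
    have := sqr_ge0 r; rewrite KE; nra.
  move=> /le_trans; apply.
  have -> : K * k.+1%:R * r ^+ 2 * expR (z ^+ 2 / k.+1%:R) =
      K * r ^+ 2 * (k.+1%:R * expR (z ^+ 2 / k.+1%:R)) by ring.
  apply: ler_wpM2l; first by rewrite mulr_ge0// sqr_ge0.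
  have k1 : 1 <= k.+1%:R :> R by rewrite ler1n.
  have := ler_wpM2l (ler0n R k.+1) (expR_ge1Dx (z ^+ 2 / k.+1%:R)).
  rewrite mulrDr mulr1 mulrC divfK ?pnatr_eq0//; lra.
move=> h; apply: le_trans (lee_wpmul2l _ h) _; first by rewrite lee_fin invr_ge0 exprn_ge0// ltW.
rewrite -EFinM lee_fin le_eqVlt; apply/orP; left; apply/eqP.
by rewrite [(r ^+ 2 / _) ^+ _]exprMn exprVn -!exprM mul2n; ring.
Qed.

(** * Second moments and the Cameron-Martin space *)

Section second_moments.
Context (d : measure_display) (Omega : measurableType d) (R : realType).
Variable P : probability Omega R.
Implicit Types f g : Omega -> R.

Lemma Lfun2_sqr_integral (Y : {RV P >-> R}) :
  (\int[P]_w (Y w ^+ 2)%:E < +oo)%E -> (Y : Omega -> R) \in Lfun P 2%:E.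
Proof.
move=> Y2; rewrite inE; apply/andP; split; rewrite inE/=; first exact: measurable_funPT.
rewrite /finite_norm unlock poweR_lty//; apply: le_lt_trans Y2.
rewrite le_eqVlt; apply/orP; left; apply/eqP; apply: eq_integral => w _ /=.
by rewrite powR_mulrn// real_normK// num_real.
Qed.

Lemma Lfun2D f g : f \in Lfun P 2%:E -> g \in Lfun P 2%:E ->
  (fun w => f w + g w) \in Lfun P 2%:E.
Proof. exact: (Lfun_addr_closed P (lee1n 2)).2. Qed.

Lemma Lfun2Z f a : f \in Lfun P 2%:E -> (fun w => a * f w) \in Lfun P 2%:E.
Proof.
move=> f2; rewrite (_ : (fun w => _) = a \o* f).
  by apply: Lfun_scale => //; rewrite ler1n.
by apply/funext => w /=; rewrite mulrC.
Qed.

Lemma Lfun2_sum (n : nat) (c : nat -> R) (f : nat -> Omega -> R) :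
  (forall i, (i < n)%N -> f i \in Lfun P 2%:E) ->
  (fun w => \sum_(0 <= i < n) c i * f i w) \in Lfun P 2%:E.
Proof.
elim: n => [|n IH] f2.
  rewrite (_ : (fun w => _) = cst 0); first exact: Lfun_cst.
  by apply/funext => w; rewrite big_nil.
under eq_fun do rewrite big_nat_recr//=.
apply: Lfun2D; last exact/Lfun2Z/f2.
by apply: IH => i /ltnW; exact: f2.
Qed.

Definition mixed_moment f g : R := fine ('E_P[(fun w => f w * g w)%R])%E.

Lemma mixed_momentC f g : mixed_moment f g = mixed_moment g f.
Proof. by rewrite /mixed_moment; under eq_fun do rewrite mulrC. Qed.

Lemma mixed_momentE f g : f \in Lfun P 2%:E -> g \in Lfun P 2%:E ->
  ('E_P[(fun w => f w * g w)%R] = (mixed_moment f g)%:E)%E.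
Proof.
by move=> f2 g2; rewrite fineK// expectation_fin_num//; exact: Lfun2_mul_Lfun1.
Qed.

Lemma mixed_momentDr f g1 g2 : f \in Lfun P 2%:E -> g1 \in Lfun P 2%:E ->
  g2 \in Lfun P 2%:E ->
  mixed_moment f (fun w => g1 w + g2 w) = mixed_moment f g1 + mixed_moment f g2.
Proof.
move=> f2 g12 g22; apply: EFin_inj; rewrite -mixed_momentE//; last exact: Lfun2D.
rewrite EFinD -!mixed_momentE// -expectationD; [|exact: Lfun2_mul_Lfun1..].
by congr expectation; apply/funext => w /=; rewrite mulrDr.
Qed.

Lemma mixed_momentZr f g a : f \in Lfun P 2%:E -> g \in Lfun P 2%:E ->
  mixed_moment f (fun w => a * g w) = a * mixed_moment f g.
Proof.
move=> f2 g2; apply: EFin_inj; rewrite -mixed_momentE//; last exact: Lfun2Z.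
rewrite EFinM -!mixed_momentE// -expectationZl; last exact: Lfun2_mul_Lfun1.
by congr expectation; apply/funext => w /=; rewrite mulrCA mulrC.
Qed.

Lemma mixed_momentBr f g1 g2 : f \in Lfun P 2%:E -> g1 \in Lfun P 2%:E ->
  g2 \in Lfun P 2%:E ->
  mixed_moment f (fun w => g1 w - g2 w) = mixed_moment f g1 - mixed_moment f g2.
Proof.
move=> f2 g12 g22; under eq_fun do rewrite -mulN1r.
rewrite mixed_momentDr//; last exact: Lfun2Z.
by rewrite mixed_momentZr// mulN1r.
Qed.

Lemma mixed_moment_sumr (n : nat) (c : nat -> R) (g : nat -> Omega -> R) f :
  f \in Lfun P 2%:E -> (forall i, (i < n)%N -> g i \in Lfun P 2%:E) ->
  mixed_moment f (fun w => \sum_(0 <= i < n) c i * g i w) =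
  \sum_(0 <= i < n) c i * mixed_moment f (g i).
Proof.
move=> f2; elim: n => [|n IH] g2.
  rewrite /mixed_moment big_nil (_ : (fun w => _) = cst 0) ?expectation_cst//.
  by apply/funext => w; rewrite big_nil mulr0.
under eq_fun do rewrite big_nat_recr//=.
have g2' i : (i < n)%N -> g i \in Lfun P 2%:E by move=> /ltnW; exact: g2.
rewrite mixed_momentDr// ?big_nat_recr//= ?IH ?mixed_momentZr//.
- exact: g2.
- exact: Lfun2_sum.
- exact/Lfun2Z/g2.
Qed.

Lemma mixed_moment_ge0 f : 0 <= mixed_moment f f.
Proof.
by rewrite fine_ge0// expectation_ge0// => w; rewrite -expr2 sqr_ge0.
Qed.

(** Expansion of E (f - g)^2 >= 0. This additive form lets the duality argument absorb a sum without
    dividing by it. *)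
Lemma mixed_moment_AMGM f g : f \in Lfun P 2%:E -> g \in Lfun P 2%:E ->
  2 * mixed_moment f g <= mixed_moment f f + mixed_moment g g.
Proof.
move=> f2 g2; have fg2 : (fun w => f w - g w) \in Lfun P 2%:E.
  by under eq_fun do rewrite -mulN1r; apply: Lfun2D => //; exact: Lfun2Z.
have := mixed_moment_ge0 (fun w => f w - g w).
have BE h : h \in Lfun P 2%:E ->
    mixed_moment (fun w => f w - g w) h = mixed_moment f h - mixed_moment g h.
  by move=> h2; rewrite mixed_momentC mixed_momentBr// !(mixed_momentC h).
rewrite mixed_momentBr// !BE// (mixed_momentC g f); lra.
Qed.

End second_moments.

(** The threshold is b = x^(2 - q). Below it the product is at most x^q; above it, it is at most
    b^rho because 2 (q - 1) = (2 - q) (rho - 1), the identity that the value of [q] provides. *)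
Lemma young_sqr_powR (R : realType) (rho q x b : R) : 1 <= rho ->
  q = (1 / (2 * rho) + 1 / 2)^-1 -> 0 <= x -> 0 <= b ->
  (x `^ (q - 1)) ^+ 2 * b <= x `^ q + b `^ rho.
Proof.
move=> rho1 qE x0 b0.
have rho0 : 0 < rho by lra.
have rhoN : rho != 0 by rewrite gt_eqF.
have rho1N : 1 + rho != 0 by rewrite gt_eqF//; lra.
have {}qE : q = 2 * rho / (1 + rho).
  by rewrite qE; field; rewrite rhoN rho1N/=; lra.
rewrite -powR_mulrn ?powR_ge0// -powRrM.
have [bx|xb] := leP b (x `^ (2 - q)).
  apply: (@le_trans _ _ (x `^ q)); last by rewrite lerDl powR_ge0.
  apply: le_trans (ler_wpM2l (powR_ge0 _ _) bx) _.
  rewrite -powRD; first by rewrite (_ : _ + _ = q) //; ring.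
  rewrite (_ : _ + _ = q); last by ring.
  by rewrite qE !mulf_eq0 invr_eq0 (negbTE rhoN) (negbTE rho1N) pnatr_eq0.
apply: (@le_trans _ _ (b `^ rho)); last by rewrite lerDr powR_ge0.
rewrite -[leRHS]mulr_powRB1// [leLHS]mulrC ler_wpM2l//.
rewrite (_ : (q - 1) * 2%:R = (2 - q) * (rho - 1)); last by rewrite qE; field.
by rewrite powRrM ge0_ler_powR ?nnegrE ?powR_ge0 ?subr_ge0// ltW.
Qed.

(* Duality: test the moments against the coefficients
   [b i = sg (a i) |a i| ^ (q - 1)], for which [\sum_i b i a i] is the left-hand
   side, and bound the variance of [\sum_i b i f i] by
   [\sum_j (b j) ^ 2 \sum_i |E (f i f j)|]. *)
Lemma sum_mixed_moment_powR_le (d : measure_display) (Omega : measurableType d)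
    (R : realType) (P : probability Omega R) (rho q : R) (n : nat)
    (Z : Omega -> R) (f : nat -> Omega -> R) :
  1 <= rho -> q = (1 / (2 * rho) + 1 / 2)^-1 ->
  Z \in Lfun P 2%:E -> (forall i, (i < n)%N -> f i \in Lfun P 2%:E) ->
  \sum_(0 <= i < n) `|mixed_moment P Z (f i)| `^ q <=
  mixed_moment P Z Z +
  \sum_(0 <= j < n) (\sum_(0 <= i < n) `|mixed_moment P (f i) (f j)|) `^ rho.
Proof.
move=> rho1 qE Z2 f2.
have q0 : 0 < q.
  by rewrite qE invr_gt0 addr_gt0// divr_gt0// mulr_gt0// (lt_le_trans ltr01).
pose a i := mixed_moment P Z (f i).
pose b i := Num.sg (a i) * `|a i| `^ (q - 1).
pose W w := \sum_(0 <= i < n) b i * f i w.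
have W2 : W \in Lfun P 2%:E by exact: Lfun2_sum.
have ZW : mixed_moment P Z W = \sum_(0 <= i < n) `|a i| `^ q.
  rewrite mixed_moment_sumr//; apply: eq_bigr => i _.
  by rewrite /b -/(a i) mulrAC -normrEsg mulr_powRB1.
have WW : mixed_moment P W W <= \sum_(0 <= j < n)
    (`|a j| `^ (q - 1)) ^+ 2 * \sum_(0 <= i < n) `|mixed_moment P (f i) (f j)|.
  (* Equality can fail: for q = 1 and a i = 0 the right-hand side is 1, as 0 to the power 0 is 1. *)
  have b2 i : b i ^+ 2 <= (`|a i| `^ (q - 1)) ^+ 2.
    by rewrite exprMn ler_piMl ?sqr_ge0// sqr_sg lern1 leq_b1.
  have -> : mixed_moment P W W =
      \sum_(0 <= j < n) \sum_(0 <= i < n) b j * b i * mixed_moment P (f i) (f j).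
    rewrite mixed_moment_sumr// !big_nat; apply: eq_bigr => j /andP[_ jn].
    rewrite mixed_momentC mixed_moment_sumr ?f2// mulr_sumr.
    by apply: eq_bigr => i _; rewrite mulrA mixed_momentC.
  (* By 2 |b i b j| <= (b i)^2 + (b j)^2 each term is at most (c i j + c j i) / 2; exchanging the
     sums shows that both halves have the same total. *)
  pose c i j := b j ^+ 2 * `|mixed_moment P (f i) (f j)|.
  apply: (@le_trans _ _ (\sum_(0 <= j < n) \sum_(0 <= i < n) (c i j + c j i) / 2)).
    apply: ler_sum => j _; apply: ler_sum => i _.
    rewrite /c (mixed_momentC P (f j)); apply: le_trans (ler_norm _) _.
    rewrite normrM [`|b j * b i|]normrM -(real_normK (num_real (b i))) -(real_normK (num_real (b j))).
    have := mulr_ge0 (normr_ge0 (mixed_moment P (f i) (f j)))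
      (sqr_ge0 (`|b i| - `|b j|)); lra.
  have -> : \sum_(0 <= j < n) \sum_(0 <= i < n) (c i j + c j i) / 2 =
      \sum_(0 <= j < n) \sum_(0 <= i < n) c i j.
    under eq_bigr do rewrite -mulr_suml big_split/=.
    rewrite -mulr_suml big_split/= [X in _ + X]exchange_big/=.
    lra.
  apply: ler_sum => j _; rewrite -mulr_sumr ler_wpM2r//.
  exact: sumr_ge0.
(* With S the sum to be bounded, 2 S <= E Z^2 + E W^2, and E W^2 is at most S plus the covariance
   term; one S is absorbed. *)
have := mixed_moment_AMGM Z2 W2; rewrite ZW => ZW2.
have : mixed_moment P W W <= \sum_(0 <= j < n) `|a j| `^ q +
    \sum_(0 <= j < n) (\sum_(0 <= i < n) `|mixed_moment P (f i) (f j)|) `^ rho.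
  rewrite -big_split/=; apply: le_trans WW _; apply: ler_sum => j _.
  by apply: young_sqr_powR => //; exact: sumr_ge0.
rewrite -/a; lra.
Qed.

Section covariance_variation.
Context (d : measure_display) (Omega : measurableType d) (R : realType).
Variables (P : probability Omega R) (T : R) (X : R -> {RV P >-> R}).
Hypothesis X2 : forall t, 0 <= t <= T -> (X t : Omega -> R) \in Lfun P 2%:E.

Let incr s t : Omega -> R := fun w => X t w - X s w.

Lemma Lfun2_increment s t : 0 <= s <= T -> 0 <= t <= T -> incr s t \in Lfun P 2%:E.
Proof.
move=> s0T t0T; rewrite /incr; under eq_fun do rewrite -mulN1r.
by apply: Lfun2D; [exact: X2|exact/Lfun2Z/X2].
Qed.

Lemma rect_incr_covariance s t u v : 0 <= s <= T -> 0 <= t <= T ->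
  0 <= u <= T -> 0 <= v <= T ->
  rect_incr (covariance_function X) s t u v =
  mixed_moment P (incr s t) (incr u v).
Proof.
move=> sT tT uT vT; rewrite mixed_momentBr ?X2 ?Lfun2_increment//.
rewrite !(mixed_momentC _ (incr s t)) !mixed_momentBr ?X2// /rect_incr.
rewrite -![covariance_function X _ _]/(mixed_moment P _ _).
rewrite !(mixed_momentC _ (X s)) !(mixed_momentC _ (X t)); ring.
Qed.

Variable rho : R.
Hypothesis rho1 : 1 <= rho.
Hypothesis RX :
  (mixed_variation 1%R rho (covariance_function X) 0%R T 0%R T < +oo)%E.

(** Both dissections of the mixed variation are taken equal to [s]. The full inner sums serve the
    Cameron-Martin paths, their diagonal terms the sample paths. *)
Lemma sum_increment_moments_bounded : exists M : R, forall s, itv_partition 0 T s ->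
  let x := nth T (0 :: s) in
  \sum_(0 <= j < size s) (\sum_(0 <= i < size s)
    `|mixed_moment P (incr (x i) (x i.+1)) (incr (x j) (x j.+1))|) `^ rho <= M.
Proof.
have rho0 : 0 < rho by rewrite (lt_le_trans ltr01).
exists (fine (mixed_variation 1%R rho (covariance_function X) 0%R T 0%R T) `^ rho).
move=> s ps /=; set x := nth T (0 :: s); set S := leLHS.
have S0 : 0 <= S by apply: sumr_ge0 => j _; exact: powR_ge0.
have xT i : (i <= size s)%N -> 0 <= x i <= T.
  by move=> si; rewrite itv_partition_nth_ge ?itv_partition_nth_le.
have SE : mixed_variation_sum 1 rho (covariance_function X) 0 T 0 T s s = S `^ rho^-1.
  rewrite /mixed_variation_sum -/x; congr (_ `^ _).
  rewrite /S !big_nat; apply: eq_bigr => j /andP[_ js]; rewrite divr1; congr (_ `^ _).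
  rewrite !big_nat; apply: eq_bigr => i /andP[_ si]; rewrite powRr1//.
  by rewrite rect_incr_covariance// xT// ltnW.
have SV : ((S `^ rho^-1)%:E <=
    mixed_variation 1%R rho (covariance_function X) 0%R T 0%R T)%E.
  rewrite -SE; apply: ereal_sup_ubound.
  exact: (ex_intro2 _ _ s ps (ex_intro2 _ _ s ps erefl)).
move: RX SV; move: (mixed_variation _ _ _ _ _ _ _) => V Vy SV.
clear SE; clearbody S.
have SfV : S `^ rho^-1 <= fine V.
  have Vfin : V \is a fin_num by rewrite fin_numElt Vy (lt_le_trans (ltNyr _) SV).
  by rewrite -lee_fin fineK.
rewrite -[leLHS](powRr1 S0) -(mulVf (lt0r_neq0 rho0)) powRrM.
by rewrite ge0_ler_powR ?nnegrE ?powR_ge0 ?(ltW rho0)// (le_trans (powR_ge0 _ _) SfV).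
Qed.

(** One element Y of the span at distance less than 1 suffices, as Z = (Z - Y) + Y. *)
Lemma process_L2_closure_Lfun2 (Z : {RV P >-> R}) :
  process_L2_closure T X Z -> (Z : Omega -> R) \in Lfun P 2%:E.
Proof.
move=> /(_ 1 ltr01)[Y [n [a [t [tT ->]]]] ZY].
have Y2 : (fun w => \sum_(i < n) a i * X (t i) w) \in Lfun P 2%:E.
  rewrite (_ : (fun w => _) = \sum_(i < n) (fun w => a i * X (t i) w)).
    elim/big_ind : _ => //.
    - exact: (Lfun_addr_closed P (lee1n 2)).1.
    - by move=> f g f2 g2; apply: (Lfun_addr_closed P (lee1n 2)).2.
    - by move=> i _; apply/Lfun2Z/X2; have := tT i; rewrite in_itv.
  by apply/funext => w; rewrite fct_sumE.
rewrite (_ : (Z : Omega -> R) = fun w =>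
    (Z w - \sum_(i < n) a i * X (t i) w) + \sum_(i < n) a i * X (t i) w); last first.
  by apply/funext => w; rewrite subrK.
apply: Lfun2D => //; rewrite inE; apply/andP; split; rewrite inE/=.
  apply: measurable_funB; first exact: measurable_funPT.
  by move: Y2; rewrite inE => /andP[/[!inE]].
exact: lt_trans ZY (ltry _).
Qed.

Lemma cameron_martin_finite_p_variation (q : R) (h : R -> R) :
  q = (1 / (2 * rho) + 1 / 2)^-1 -> cameron_martin T X h ->
  finite_p_variation q 0 T h.
Proof.
move=> qE [Z /process_L2_closure_Lfun2 Z2 hE].
have [M MP] := sum_increment_moments_bounded.
rewrite /finite_p_variation /p_variation.
apply: (@le_lt_trans _ _ (mixed_moment P Z Z + M)%:E); last by rewrite ltry.
apply: ge_ereal_sup => _ [s ps <-]; rewrite lee_fin /p_variation_sum/=.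
pose x := nth T (0 :: s); rewrite -/x.
have xT i : (i <= size s)%N -> 0 <= x i <= T.
  by move=> si; rewrite itv_partition_nth_ge ?itv_partition_nth_le.
have hZ t : 0 <= t <= T -> h t = mixed_moment P Z (X t).
  by move=> tT; apply: EFin_inj; rewrite hE ?in_itv// mixed_momentE// X2.
have := sum_mixed_moment_powR_le rho1 qE Z2 (n := size s)
  (f := fun i => incr (x i) (x i.+1)).
have f2 i : (i < size s)%N -> incr (x i) (x i.+1) \in Lfun P 2%:E.
  by move=> si; rewrite Lfun2_increment// xT// ltnW.
move=> /(_ f2) S_le; have := MP _ ps; rewrite -/x => SM.
apply: le_trans (le_trans S_le _); last by rewrite lerD2l.
rewrite !big_nat le_eqVlt; apply/orP; left; apply/eqP; apply: eq_bigr => i /andP[_ si].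
have xi := xT i (ltnW si); have xi1 := xT i.+1 si.
by rewrite (mixed_momentBr Z2 (X2 xi1) (X2 xi)) -(hZ _ xi) -(hZ _ xi1).
Qed.

End covariance_variation.

(** * Sample paths *)

Lemma powR_lt1 (R : realType) (x e : R) : 0 < x < 1 -> 0 < e -> x `^ e < 1.
Proof.
move=> /andP[x0 x1] e0; have := gt0_ltr_powR e0 (ltW x0) ler01 x1.
by rewrite powR1.
Qed.

Lemma nested_subset (T : eqType) (U : nat -> seq T) (m n : nat) :
  (forall n, {subset U n <= U n.+1}) -> (m <= n)%N -> {subset U m <= U n}.
Proof.
move=> US; apply: (homo_leq (r := fun A B : seq T => {subset A <= B})) => [A u|B A C AB BC u uA|//] //.
by apply: BC; exact: AB.
Qed.

Lemma measure_bigsetU_le_size (d : measure_display) (T : measurableType d)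
    (R : realType) (mu : {measure set T -> \bar R}) (I : Type) (s : seq I)
    (A : I -> set T) (c : R) : (forall i, measurable (A i)) ->
  (forall i, mu (A i) <= c%:E)%E ->
  (mu (\big[setU/set0]_(i <- s) A i) <= ((size s)%:R * c)%:E)%E.
Proof.
move=> mA Ac; elim: s => [|i s IH]; first by rewrite big_nil measure0 mul0r.
rewrite big_cons; apply: le_trans (measureU2 _ _ _) _ => //.
  exact: bigsetU_measurable.
by rewrite /= -natr1 mulrDl mul1r addrC EFinD leeD.
Qed.

(** Borel-Cantelli, with the bound in the geometric form that [epsilon_trick] sums to [c]. *)
Lemma ae_eventually_notin (d : measure_display) (T : measurableType d)
    (R : realType) (mu : {measure set T -> \bar R}) (E : nat -> set T) (c : R) :
  (forall n, measurable (E n)) -> 0 <= c ->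
  (forall n, mu (E n) <= (c / (2 ^ n.+1)%:R)%:E)%E ->
  {ae mu, forall w, exists n0, forall n, (n0 <= n)%N -> ~ E n w}.
Proof.
move=> mE c0 Ec; exists (lim_sup_set E); split.
- by apply: bigcapT_measurable => n; apply: bigcup_measurable => k _.
- apply: lim_sup_set_cvg0 => //.
  apply: (@le_lt_trans _ _ (\sum_(0 <= n <oo) (0 + (c / (2 ^ n.+1)%:R)%:E))%E).
    by apply: lee_nneseries => n _; rewrite ?measure_ge0// add0e.
  apply: le_lt_trans (epsilon_trick xpredT (fun=> lexx 0%E) c0) _.
  by rewrite eseries0// add0e ltry.
move=> w /= nE n _; apply: contrapT => nEn; apply: nE; exists n => k nk Ekw.
by apply: nEn; exists k.
Qed.

(* If [E Y^2 <= D^(1/rho)] with [D] of order [2^-n], then the standard deviation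
   of [Y] is of order [2^(-n/(2 rho))], much smaller than [2^(-n/p)]. *)
Lemma gaussian_increment_tail (d : measure_display) (Omega : measurableType d)
    (R : realType) (P : probability Omega R) (rho p : R) :
  1 <= rho -> 2 * rho < p -> exists2 C : R, 0 <= C &
  forall (Y : {RV P >-> R}) (D : R) (n : nat), gaussian_law P Y ->
    (\int[P]_w (Y w ^+ 2)%:E <= (D `^ rho^-1)%:E)%E ->
    0 <= D <= 3 * 2^-1 ^+ n ->
    (P [set w | ((2^-1 `^ p^-1) ^+ n <= `|Y w|)%R] <= (C * 8^-1 ^+ n)%:E)%E.
Proof.
move=> rho1 rhop; have rho0 : 0 < rho by lra.
have p0 : 0 < p by lra.
pose h : R := 2^-1; have h0 : 0 < h by rewrite invr_gt0.
(* Up to a constant, eta^n is the variance at level n over the squared threshold; eta < 1 amounts to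
   p > 2 rho. *)
pose eta := h `^ (rho^-1 - 2 * p^-1).
have eta0 : 0 < eta by rewrite powR_gt0.
have eta1 : eta < 1.
  have h1 : h < 1 by rewrite invf_lt1//; lra.
  apply: powR_lt1 => //; first by rewrite h0.
  by rewrite subr_gt0 ltr_pdivrMr// ltr_pdivlMl// mulrC.
(* A high enough moment gives the decay 8^-n, which beats the order 4^n of the number of pairs of
   net points and leaves 2^-n. *)
have [k etak] : exists k, eta ^+ k.+1 <= 8^-1.
  have /cvg_expr/cvgrPdist_lt/(_ 8^-1)[|m _ /(_ m.+1 (leqnSn m))] : `|eta| < 1.
  - by rewrite gtr0_norm.
  - by rewrite invr_gt0.
  rewrite /= sub0r normrN ger0_norm ?exprn_ge0 ?(ltW eta0)// => me.
  by exists m; exact: ltW.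
have [c c0 tail] := gaussian_law_tail P k.
exists (c * (3 `^ rho^-1) ^+ k.+1); first by rewrite mulr_ge0// exprn_ge0// powR_ge0.
move=> Y D n gY Y2 /andP[D0 Dn].
pose r := (3 * h ^+ n) `^ (2 * rho)^-1.
have hn0 : 0 < 3 * h ^+ n by rewrite mulr_gt0// exprn_gt0.
have r0 : 0 < r by rewrite powR_gt0.
have t0 : 0 < (h `^ p^-1) ^+ n by rewrite exprn_gt0// powR_gt0.
have r2 : r ^+ 2 = (3 * h ^+ n) `^ rho^-1.
  rewrite -powR_mulrn ?(ltW r0)// -powRrM; congr (_ `^ _).
  by field; rewrite gt_eqF.
have rt : r ^+ 2 / ((h `^ p^-1) ^+ n) ^+ 2 = 3 `^ rho^-1 * eta ^+ n.
  rewrite r2 powRM ?exprn_ge0 ?(ltW h0)// -mulrA; congr (_ * _).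
  rewrite -(powR_mulrn n (ltW h0)) -powRrM -exprM.
  rewrite -(powR_mulrn _ (powR_ge0 _ _)) -powRrM -powRN -powRD; last first.
    by rewrite (gt_eqF h0) implybT.
  rewrite -(powR_mulrn _ (ltW eta0)) -powRrM natrM; congr (_ `^ _); ring.
apply: le_trans (tail Y _ _ gY r0 t0 _) _.
  by rewrite r2; apply: le_trans Y2 _; rewrite lee_fin ge0_ler_powR ?nnegrE ?invr_ge0 ?(ltW rho0)// ltW.
have e8 : (eta ^+ n) ^+ k.+1 <= 8^-1 ^+ n.
  by rewrite -exprM mulnC exprM lerXn2r// nnegrE ?invr_ge0// exprn_ge0// ltW.
rewrite lee_fin rt exprMn mulrA; apply: ler_wpM2l e8.
by rewrite mulr_ge0// exprn_ge0// powR_ge0.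
Qed.

Section gaussian_p_variation.
Context (d : measure_display) (Omega : measurableType d) (R : realType).
Variables (P : probability Omega R) (T : R) (X : R -> {RV P >-> R}).
Hypothesis T0 : 0 < T.
Hypothesis gaussX : gaussian_process T X.

Let incr s t : {RV P >-> R} := X t \- X s.

Lemma gaussian_process_Lfun2 t : 0 <= t <= T -> (X t : Omega -> R) \in Lfun P 2%:E.
Proof.
move=> tT; apply/Lfun2_sqr_integral/gaussian_law_sqr_integral/gaussX.
exists 1%N, (fun=> 1), (fun=> t); split; first by move=> _; rewrite in_itv.
by apply/funext => w; rewrite big_ord_recl big_ord0 mul1r addr0.
Qed.

Lemma gaussian_law_increment s t : 0 <= s <= T -> 0 <= t <= T ->
  gaussian_law P (incr s t).
Proof.
move=> sT tT; apply: gaussX.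
exists 2%N, (fun i => if i == 0 then 1 else -1), (fun i => if i == 0 then t else s).
split; first by move=> i; case: ifP => _; rewrite in_itv.
by apply/funext => w; rewrite !big_ord_recl big_ord0/= mul1r mulN1r addr0.
Qed.

Lemma sqr_increment_integral s t : 0 <= s <= T -> 0 <= t <= T ->
  (\int[P]_w (incr s t w ^+ 2)%:E =
   (mixed_moment P (fun w => X t w - X s w) (fun w => X t w - X s w))%:E)%E.
Proof.
move=> sT tT; have L2 := gaussian_process_Lfun2.
have I2 := Lfun2_increment L2 sT tT.
by rewrite -(mixed_momentE I2 I2) unlock; apply: eq_integral => w _; rewrite expr2.
Qed.

(** [E n] is the event that some pair of nearby points of [U n] and [U n.+1] has an increment of at
    least theta^n. Almost surely it fails for all large n, and then the argument is pathwise: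
    [chaining], [dense_net_increments] and [control_finite_p_variation]. *)
Lemma gaussian_control_ae_finite_p_variation (F : R -> R) (M rho p : R) :
  continuous_process T X -> 1 <= rho -> 2 * rho < p ->
  (forall t, 0 <= t <= T -> 0 <= F t <= M) ->
  (forall s t, 0 <= s -> s < t -> t <= T -> t - s <= F t - F s) ->
  (forall s t, 0 <= s -> s < t -> t <= T ->
    (\int[P]_w (incr s t w ^+ 2)%:E <= ((F t - F s) `^ rho^-1)%:E)%E) ->
  {ae P, forall w, finite_p_variation p 0 T (fun t => X t w)}.
Proof.
move=> contX rho1 rhop FM Fid FX.
have p0 : 0 < p by lra.
have [U [US UT net] [N UN]] := exists_nets T0 FM.
have [C C0 tailX] := gaussian_increment_tail P rho1 rhop.
pose theta : R := 2^-1 `^ p^-1.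
have theta0 : 0 < theta by rewrite powR_gt0.
have theta1 : theta < 1.
  apply: powR_lt1; rewrite ?invr_gt0// ltr0n/= invf_lt1//; lra.
have pairX n u v : u \in U n -> v \in U n.+1 -> `|F u - F v| <= 3 * 2^-1 ^+ n ->
    (P [set w | (theta ^+ n <= `|X u w - X v w|)%R] <= (C * 8^-1 ^+ n)%:E)%E.
  move=> /UT uT /UT vT; wlog uv : u v uT vT / v <= u => [H Fuv|].
    have [vu|/ltW uv] := leP v u; first exact: H.
    under eq_set do rewrite distrC.
    by apply: H => //; rewrite distrC.
  move: uv; rewrite le_eqVlt => /predU1P[<- _|vu Fuv].
    rewrite (_ : [set w | _] = set0) ?measure0 ?lee_fin ?mulr_ge0 ?exprn_ge0//.
    by apply/seteqP; split => w //=; rewrite subrr normr0 leNgt exprn_gt0.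
  have [/andP[v0 vT'] /andP[u0 uT']] := (vT, uT).
  apply: (tailX (incr v u) (F u - F v)).
  - exact: gaussian_law_increment.
  - exact: FX.
  - have := Fid v u v0 vu uT'; move: Fuv; rewrite ler_norml => /andP[_ ->].
    by rewrite andbT; lra.
(* The empty default makes the probability bound hold for all [u] and [v], as
   [measure_bigsetU_le_size] demands. *)
pose A n u v := if (u \in U n) && (v \in U n.+1) && (`|F u - F v| <= 3 * 2^-1 ^+ n)
  then [set w | theta ^+ n <= `|X u w - X v w|] else set0.
have mA n u v : measurable (A n u v).
  rewrite /A; case: ifP => // _.
  exact: (measurable_norm_ge (X u \- X v)).
have PA n u v : (P (A n u v) <= (C * 8^-1 ^+ n)%:E)%E.
  rewrite /A; case: ifP => [/andP[/andP[uU vU] Fuv]|_]; first exact: pairX.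
  by rewrite measure0 lee_fin mulr_ge0 ?exprn_ge0.
pose E n := \big[setU/set0]_(u <- U n) \big[setU/set0]_(v <- U n.+1) A n u v.
have mE n : measurable (E n).
  by apply: bigsetU_measurable => u _; exact: bigsetU_measurable.
(* The union bound is (N 2^n) (N 2^(n+1)) C 8^-n = 2 N^2 C 2^-n. *)
have PE n : (P (E n) <= ((4 * N%:R ^+ 2 * C) / (2 ^ n.+1)%:R)%:E)%E.
  apply: le_trans (measure_bigsetU_le_size (U n) _ (fun u =>
    measure_bigsetU_le_size (U n.+1) (mA n u) (PA n u))) _.
    by move=> u; exact: bigsetU_measurable.
  rewrite lee_fin.
  apply: (@le_trans _ _ ((N * 2 ^ n)%:R * ((N * 2 ^ n.+1)%:R * (C * 8^-1 ^+ n)))).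
    have c0 : 0 <= C * 8^-1 ^+ n :> R by rewrite mulr_ge0// exprn_ge0.
    by rewrite ler_pM ?mulr_ge0 ?ler_nat// ler_wpM2r// ler_nat.
  rewrite !natrM !natrX exprS (_ : 8 = 2 * 2 * 2 :> R); last by ring.
  rewrite !exprVn !exprMn le_eqVlt; apply/orP; left; apply/eqP.
  by field; rewrite expf_neq0.
have c0 : 0 <= 4 * N%:R ^+ 2 * C :> R by rewrite !mulr_ge0// exprn_ge0.
have aeE := ae_eventually_notin mE c0 PE.
apply: filterS2 contX aeE => w cX [n0 nE].
have step n u v : (n0 <= n)%N -> u \in U n -> v \in U n.+1 ->
    `|F u - F v| <= 3 * 2^-1 ^+ n -> `|X u w - X v w| <= theta ^+ n.
  move=> n0n uU vU Fuv; rewrite leNgt; apply/negP => /ltW tXuv.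
  apply: (nE n n0n); rewrite /E -!bigcup_seq; exists u => //=.
  by rewrite -bigcup_seq; exists v => //=; rewrite /A uU vU Fuv.
have chn := chaining (introT andP (conj theta0 theta1)) US
  (fun m n t (tU : t \in U m) => net n t (UT m t tU)) step.
apply: (@control_finite_p_variation R F _ 0 T p n0 (3 / (1 - theta))) => //.
- by rewrite divr_ge0// subr_ge0 ltW.
- by move=> s t s0 st tT; have := Fid s t s0 st tT; lra.
move=> n s t n0n s0 st tT Fst.
apply: (@dense_net_increments R F (fun t => X t w) 0 T _ (2^-1 ^+ n) U) => //.
move=> m m' u v uU vU Fuv; apply: (chn n (maxn m m')) => //.
- exact: nested_subset US (leq_maxl m m') _ uU.
- exact: nested_subset US (leq_maxr m m') _ vU.
Qed.

Lemma gaussian_process_ae_finite_p_variation (rho p : R) :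
  continuous_process T X -> 1 <= rho -> 2 * rho < p ->
  (mixed_variation 1%R rho (covariance_function X) 0%R T 0%R T < +oo)%E ->
  {ae P, forall w, finite_p_variation p 0 T (fun t => X t w)}.
Proof.
move=> contX rho1 rhop RX.
have rho0 : 0 < rho by rewrite (lt_le_trans ltr01).
have L2 := gaussian_process_Lfun2.
have [M MP] := sum_increment_moments_bounded L2 rho1 RX.
pose v s t := mixed_moment P (fun w => X t w - X s w) (fun w => X t w - X s w).
have v0 s t : 0 <= v s t by exact: mixed_moment_ge0.
have vM s : itv_partition 0 T s -> \sum_(0 <= i < size s)
    v (nth T (0 :: s) i) (nth T (0 :: s) i.+1) `^ rho <= M.
  move=> ps; apply: le_trans (MP s ps); rewrite /= !big_nat.
  apply: ler_sum => j /andP[_ js].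
  rewrite ge0_ler_powR ?nnegrE ?(ltW rho0)//; first exact: sumr_ge0.
  (* Only the diagonal term i = j of the inner sum is kept. *)
  rewrite big_mkord (bigD1 (Ordinal js))//=.
  by rewrite (le_trans (ler_norm _))// lerDl sumr_ge0.
have [F [FM Fv Fid]] := exists_control T0 (fun s t => powR_ge0 (v s t) rho) vM.
apply: (@gaussian_control_ae_finite_p_variation F (M + (T - 0)) rho) => //.
move=> s t s0 st tT; have stT : 0 <= s <= T /\ 0 <= t <= T by split; lra.
have [sT tT'] := stT.
rewrite sqr_increment_integral// lee_fin -[leLHS](powRr1 (v0 s t)).
rewrite -(mulfV (lt0r_neq0 rho0)) powRrM ge0_ler_powR ?nnegrE ?powR_ge0 ?invr_ge0 ?(ltW rho0)//.
- have := Fid s t s0 st tT; lra.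
- exact: Fv.
Qed.

End gaussian_p_variation.

Theorem corollary1p2 (d : measure_display) (Omega : measurableType d)
    (R : realType) (P : probability Omega R) (T : R) (X : R -> {RV P >-> R})
    (rho q : R) (hT : 0 < T)
    (hgauss : gaussian_process T X)
    (hcent : centered_process T X)
    (hcont : continuous_process T X)
    (hrho : 1 <= rho < 2)
    (hR : (mixed_variation 1%R rho (covariance_function X) 0%R T 0%R T < +oo)%E)
    (hq : q = (1 / (2 * rho) + 1 / 2)^-1) :
  exists p : R,
    [/\ 2 * rho < p,
        {ae P, forall w, finite_p_variation p 0 T (fun t : R => X t w)},
        (forall h : R -> R, cameron_martin T X h -> finite_p_variation q 0 T h)
      & 1 / p + 1 / q > 1].
Proof.
case/andP: hrho => rho1 rho2.
have L2 := gaussian_process_Lfun2 hgauss.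
exists 4; split; first by lra.
- by apply: (gaussian_process_ae_finite_p_variation hT hgauss hcont rho1); first lra.
- by move=> h hC; exact: (cameron_martin_finite_p_variation L2 rho1 hR hq hC).
have rhoi : 4^-1 < (2 * rho)^-1 by rewrite ltf_pV2 ?posrE ?mulr_gt0//; lra.
rewrite hq !div1r invrK; lra.
Qed.
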